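(* Let $(V,p,e)$ be a hyperbolic system of degree $n$. Then $(V,p,e)$ admits a Jordan frame if and only if it contains a subsystem $(W,p,e)$ that is isomorphic to $(\mathbb{R}^n,E_n,\mathbf{1})$; equivalently, if and only if $(V,p,e)$ contains a copy of the Euclidean Jordan algebra $\mathbb{R}^n$.
   Context: Let $V$ be a finite-dimensional real vector space and $e\in V$ nonzero. A homogeneous polynomial $p$ of degree $n$ on $V$ is hyperbolic in the direction $e$ if $p(e)\ne 0$ and for every $x\in V$ the univariate polynomial $t\mapsto p(te-x)$ has only real zeros; then $(V,p,e)$ is called a hyperbolic system of degree $n$. Standing assumption: $n\ge 2$. The eigenvalue map $\lambda:V\to\mathbb{R}^n$ sends $x$ to the vector of roots of $t\mapsto p(te-x)$, with multiplicity, in decreasing order. An element $c$ is a primitive idempotent if $\lambda(c)=(1,0,\ldots,0)^T$. A Jordan frame in $(V,p,e)$ is a finite family $c_1,\ldots,c_k$ of primitive idempotents with $c_1+\cdots+c_k=e$. For $u\in\mathbb{R}^n$, $u^\downarrow$ denotes its decreasing rearrangement. $E_n(x)=x_1x_2\cdots x_n$ and $\mathbf{1}$ is the vector of ones, so $(\mathbb{R}^n,E_n,\mathbf{1})$ is a hyperbolic system of degree $n$ whose eigenvalue map is $x\mapsto x^\downarrow$. A subsystem $(W,p,e)$ of $(V,p,e)$ is given by a linear subspace $W\subseteq V$ containing $e$, with $p$ and $\lambda$ restricted to $W$. An isomorphism between $(W,p,e)$ and $(\mathbb{R}^n,E_n,\mathbf{1})$ is a bijective linear map $\phi:W\to\mathbb{R}^n$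 with $\phi(x)^\downarrow=\lambda(x)$ for all $x\in W$. The semi-inner product on $V$ is $\langle x,y\rangle=\frac14\big[\|\lambda(x+y)\|^2-\|\lambda(x-y)\|^2\big]$ with the Euclidean norm on $\mathbb{R}^n$. The Euclidean Jordan algebra $\mathbb{R}^n$ carries the usual inner product and the componentwise product, with unit $\mathbf{1}$; the eigenvalues of an element are its coordinates. ''$(V,p,e)$ contains a copy of the Euclidean Jordan algebra $\mathbb{R}^n$'' means: there is a linear subspace $W\subseteq V$ containing $e$ and a bilinear product $\circ$ on $W$ such that $W$, with $\circ$ and the restriction of $\langle\cdot,\cdot\rangle$, is a Euclidean Jordan algebra with unit $e$, isomorphic to the Euclidean Jordan algebra $\mathbb{R}^n$ (via a linear bijection preserving products and inner products), and such that the Jordan-algebra eigenvalues of each $x\in W$ are the entries of $\lambda(x)$. *)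

(* Defs.v *)
From HB Require Import structures.
From mathcomp Require Import all_boot all_order all_algebra.
From mathcomp Require Import polyrcf complex mpoly.
From mathcomp Require Import boolp classical_sets reals.

Set Implicit Arguments.
Unset Strict Implicit.
Unset Printing Implicit Defensive.

Import Order.TTheory GRing.Theory Num.Theory.
Local Open Scope ring_scope.

Section Hyperbolic.
Variables (R : realType) (V : vectType R).
Implicit Types (p : V -> R) (e x y c : V).

(* Being a polynomial, and its degree, do not depend on the basis of V used
   for the coordinates; R is infinite, so a polynomial function determines
   its formal polynomial. *)
Definition homogeneous_poly (n : nat) p : Prop :=
  exists2 P : {mpoly R[\dim {:V}]}, P \is n.-homog &
    forall x, p x = P.@[fun i => coord (vbasis {:V}) i x].

(* The formal polynomial of the function t |-> p (te - x); it exists and is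
   unique when p is polynomial, see line_polyE below. *)
Definition line_poly p e x : {poly R} :=
  xget 0 [set q : {poly R} | forall t, q.[t] = p (t *: e - x)].

(* Zeros are taken in the complex numbers R[i]. *)
Definition only_real_zeros (q : {poly R}) : Prop :=
  forall z : R[i], root (map_poly (real_complex R) q) z -> complex.Im z = 0.

Record hyperbolic_system (n : nat) p e : Prop := HyperbolicSystem {
  hyp_dir_neq0 : e != 0;
  hyp_homog : homogeneous_poly n p;
  hyp_val_neq0 : p e != 0;
  hyp_real : forall x, only_real_zeros (line_poly p e x)
}.

Definition roots_with_mult (q : {poly R}) : seq R :=
  flatten [seq nseq (mup a q) a | a <- rootsR q].

(* Default value 0 outside the sequence; it is never used for a hyperbolic
   system of degree n, where the sequence has size n (size_roots below). *)
Definition eigenvalue_map (n : nat) p e x : 'rV[R]_n :=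
  \row_(i < n) (sort >=%R (roots_with_mult (line_poly p e x)))`_i.

Definition primitive_idempotent (n : nat) p e c : Prop :=
  eigenvalue_map n p e c = \row_(i < n) (i == 0 :> nat)%:R.

Definition jordan_frame (n : nat) p e (k : nat) (c : 'I_k -> V) : Prop :=
  (forall i, primitive_idempotent n p e (c i)) /\ \sum_(i < k) c i = e.

Definition sqnorm2 (n : nat) (u : 'rV[R]_n) : R := \sum_(i < n) u 0 i ^+ 2.

Definition semi_inner (n : nat) p e x y : R :=
  4^-1 * (sqnorm2 (eigenvalue_map n p e (x + y))
          - sqnorm2 (eigenvalue_map n p e (x - y))).

End Hyperbolic.

Definition decr (R : realType) (n : nat) (u : 'rV[R]_n) : 'rV[R]_n :=
  \row_(i < n) (sort >=%R [seq u 0 j | j <- enum 'I_n])`_i.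

Definition En (R : realType) (n : nat) (u : 'rV[R]_n) : R := \prod_(i < n) u 0 i.

Lemma poly_fun_inj (R : realType) (q1 q2 : {poly R}) :
  (forall t, q1.[t] = q2.[t]) -> q1 = q2.
Proof.
move=> E; apply/eqP; rewrite -subr_eq0; apply/eqP.
pose q := q1 - q2.
apply: (@roots_geq_poly_eq0 _ q [seq i%:R | i <- iota 0 (size q)]).
- by apply/allP => t _; rewrite /root /q hornerD hornerN E subrr.
- rewrite map_inj_uniq ?iota_uniq // => i j.
  by move/eqP; rewrite eqr_nat => /eqP.
- by rewrite size_map size_iota.
Qed.

Lemma line_poly_eq (R : realType) (V : vectType R) (p : V -> R) (e x : V)
    (q : {poly R}) :
  (forall t, q.[t] = p (t *: e - x)) -> line_poly p e x = q.
Proof.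
move=> qE; apply: poly_fun_inj => t; rewrite qE.
have := @xgetPex _ 0 [set q : {poly R} | forall t, q.[t] = p (t *: e - x)].
by apply; exists q.
Qed.

Lemma line_polyE (R : realType) (V : vectType R) (n : nat) (p : V -> R)
    (e x : V) : homogeneous_poly n p ->
  [/\ forall t, (line_poly p e x).[t] = p (t *: e - x),
      (size (line_poly p e x) <= n.+1)%N & (line_poly p e x)`_n = p e].
Proof.
case=> P Phom pE.
pose h i := coord (vbasis {:V}) i e *: 'X - (coord (vbasis {:V}) i x)%:P.
pose q := \sum_(m <- msupp P) P@_m *: \prod_i h i ^+ m i.
have qE t : q.[t] = p (t *: e - x).
  rewrite pE mevalE horner_sum; apply: eq_bigr => m _.
  rewrite hornerZ horner_prod; congr (_ * _); apply: eq_bigr => i _.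
  by rewrite horner_exp /h !hornerE linearB linearZ /= mulrC.
rewrite (line_poly_eq qE).
pose D d (c : R) (r : {poly R}) := (size r <= d.+1)%N /\ r`_d = c.
have D1 : D 0%N 1 1 by rewrite /D size_poly1 coef1.
have DM d1 d2 c1 c2 r1 r2 : D d1 c1 r1 -> D d2 c2 r2 ->
    D (d1 + d2)%N (c1 * c2) (r1 * r2).
  move=> [s1 e1] [s2 e2]; split.
    apply: leq_trans (size_polyMleq _ _) _.
    by rewrite -subn1 leq_subLR add1n -addSn -addnS leq_add.
  rewrite coefM (bigD1 (inord d1)) //= inordK ?ltnS ?leq_addr //.
  rewrite addKn e1 e2 big1 ?addr0 // => i neq.
  have ne : (i != d1 :> nat)%N.
    apply: contraNN neq => /eqP id1; apply/eqP/val_inj.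
    by rewrite /= inordK ?id1 // ltnS leq_addr.
  case: (ltngtP i d1) ne => // lt _; last first.
    by rewrite nth_default ?mul0r //; apply: leq_trans s1 _.
  rewrite [X in _ * X]nth_default ?mulr0 //; apply: leq_trans s2 _.
  by rewrite ltn_subRL ltn_add2r.
have DX d c r k : D d c r -> D (d * k)%N (c ^+ k) (r ^+ k).
  move=> Dr; elim: k => [|k IH]; first by rewrite muln0.
  by rewrite mulnS !exprS; apply: DM.
have Dh i : D 1%N (coord (vbasis {:V}) i e) (h i).
  split; last by rewrite coefB coefZ coefX coefC /= mulr1 subr0.
  apply: leq_trans (size_polyD _ _) _; rewrite geq_max; apply/andP; split.
    by apply: leq_trans (size_scale_leq _ _) _; rewrite size_polyX.
  by rewrite size_polyN; apply: leq_trans (size_polyC_leq1 _) _.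
have Dm m : D (mdeg m) (\prod_i coord (vbasis {:V}) i e ^+ m i)
    (\prod_i h i ^+ m i).
  rewrite mdegE; elim/big_rec3: _ => // i c r d _ IH.
  by apply: DM => //; have := DX _ _ _ (m i) (Dh i); rewrite mul1n.
have Pm m : m \in msupp P -> mdeg m = n by move/dhomogP: Phom => /(_ m).
split=> //.
- rewrite /q; apply: (leq_trans (size_sum _ _ _)); apply/bigmax_leqP_seq.
  move=> m mP _; apply: leq_trans (size_scale_leq _ _) _.
  by rewrite -(Pm m mP); case: (Dm m).
- rewrite pE mevalE /q coef_sum; apply: eq_big_seq => m mP.
  by rewrite coefZ -(Pm m mP); case: (Dm m) => _ ->.
Qed.

Lemma perm_roots_with_mult (R : realType) (c : R) (s : seq R) : c != 0 ->
  perm_eq (roots_with_mult (c *: \prod_(a <- s) ('X - a%:P))) s.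
Proof.
move=> c0; set q := c *: _.
have prod0 : \prod_(a <- s) ('X - a%:P) != 0 :> {poly R}.
  by rewrite monic_neq0 // monic_prod_XsubC.
have q0 : q != 0 by rewrite scaler_eq0 negb_or c0.
have muE a : mup a q = count_mem a s.
  rewrite /q -mul_polyC mupMr ?mu_prod_XsubC //.
  by rewrite rootC.
apply/allP => a _ /=; rewrite /roots_with_mult count_flatten -map_comp.
have -> : [seq (count_mem a \o (fun b => nseq (mup b q) b)) b | b <- rootsR q]
    = [seq (if b == a then count_mem a s else 0)%N | b <- rootsR q].
  apply: eq_map => b /=; rewrite count_nseq /= muE.
  by case: eqP => [->|_]; rewrite ?mul1n ?mul0n.
rewrite sumnE big_map -big_mkcond /= big_const_seq iter_addn_0.
have us : uniq (rootsR q) by apply: uniq_roots.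
rewrite (count_uniq_mem _ us).
have -> : (a \in rootsR q) = (a \in s).
  have /roots_on_rootsR/(_ a) := q0; rewrite in_itv /= => <-.
  by rewrite /q rootZ // root_prod_XsubC.
by case: (boolP (a \in s)) => [|/count_memPn ->]; rewrite ?muln1 ?muln0.
Qed.

Lemma roots_with_multE (R : realType) (q : {poly R}) :
  q != 0 -> only_real_zeros q ->
  q = lead_coef q *: \prod_(a <- roots_with_mult q) ('X - a%:P).
Proof.
move=> q0 qr.
have [s sE] := closed_field_poly_normal (map_poly (real_complex R) q).
have qE : q = lead_coef q *: \prod_(a <- map (@complex.Re R) s) ('X - a%:P).
  rewrite big_map.
  apply: (map_poly_inj (real_complex R)); rewrite sE lead_coef_map.
  rewrite map_polyZ rmorph_prod /=; congr (_ *: _).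
  apply: eq_big_seq => z zs; rewrite rmorphB /= map_polyX map_polyC /=.
  have := qr z; rewrite sE rootZ ?lead_coef_eq0 ?map_poly_eq0 //.
  by rewrite root_prod_XsubC => /(_ zs); case: z zs => a b /= _ ->.
have l0 : lead_coef q != 0 by rewrite lead_coef_eq0.
rewrite [LHS]qE; congr (_ *: _); apply: perm_big; rewrite perm_sym.
by rewrite [in roots_with_mult _]qE perm_roots_with_mult.
Qed.

Lemma size_roots (R : realType) (V : vectType R) (n : nat) (p : V -> R)
    (e x : V) : hyperbolic_system n p e ->
  line_poly p e x =
    p e *: \prod_(a <- roots_with_mult (line_poly p e x)) ('X - a%:P) /\
  size (roots_with_mult (line_poly p e x)) = n.
Proof.
case=> _ hom pe0 /(_ x) rz.
have [_ sle cn] := line_polyE e x hom.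
have sn : size (line_poly p e x) = n.+1.
  apply/eqP; rewrite eqn_leq sle ltnNge; apply: contra pe0 => le.
  by rewrite -cn nth_default.
have q0 : line_poly p e x != 0 by rewrite -size_poly_eq0 sn.
have := roots_with_multE q0 rz; rewrite lead_coefE sn /= cn => qE.
split=> //; move: sn; rewrite [in LHS]qE size_scale //.
by rewrite size_prod_XsubC => -[].
Qed.

Lemma En_eigenvalue_map (R : realType) (n : nat) (u : 'rV[R]_n) :
  eigenvalue_map n (@En R n) (const_mx 1) u = decr u.
Proof.
rewrite /eigenvalue_map /decr.
have -> : line_poly (@En R n) (const_mx 1) u =
    1 *: \prod_(a <- [seq u 0 j | j <- enum 'I_n]) ('X - a%:P).
  apply: line_poly_eq => t; rewrite scale1r big_map big_enum horner_prod.
  by apply: eq_bigr => i _; rewrite !hornerE !mxE mulr1.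
apply/rowP => i; rewrite !mxE; congr (_`_i).
apply/perm_sortP; last by apply: perm_roots_with_mult; rewrite oner_eq0.
- by move=> a b; rewrite /= le_total.
- by move=> b a c /= h1 h2; apply: le_trans h2 h1.
- by move=> a b /=; rewrite andbC => /le_anti.
Qed.

(* The system (R^n, En, 1) enters through its eigenvalue map only, which is
   decr by En_eigenvalue_map below. *)
Definition isomorphic_to_En (R : realType) (V : vectType R) (n : nat)
    (p : V -> R) (e : V) (W : {vspace V}) : Prop :=
  exists phi : {linear subvs_of W -> 'rV[R]_n},
    bijective phi /\
    forall x : subvs_of W, decr (phi x) = eigenvalue_map n p e (vsval x).

Section EuclideanJordan.
Variable R : realType.

Record euclidean_jordan_algebra (A : vectType R) (mul : A -> A -> A)
    (dot : A -> A -> R) (u : A) : Prop := EuclideanJordanAlgebra {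
  eja_linearl : forall b, linear (fun a => mul a b);
  eja_linearr : forall a, linear (mul a);
  eja_mulC : commutative mul;
  eja_jordan : forall a b, mul a (mul (mul a a) b) = mul (mul a a) (mul a b);
  eja_mul1 : forall a, mul u a = a;
  eja_dot_linearl : forall b, scalar (fun a => dot a b);
  eja_dotC : forall a b, dot a b = dot b a;
  eja_dot_gt0 : forall a, a != 0 -> 0 < dot a a;
  eja_dot_assoc : forall a b c, dot (mul a b) c = dot b (mul a c)
}.

Definition eja_isomorphism (A B : vectType R)
    (mulA : A -> A -> A) (dotA : A -> A -> R)
    (mulB : B -> B -> B) (dotB : B -> B -> R) (f : {linear A -> B}) : Prop :=
  [/\ bijective f,
      forall a b, f (mulA a b) = mulB (f a) (f b) &
      forall a b, dotB (f a) (f b) = dotA a b].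

Definition eja_idempotent (A : vectType R) (mul : A -> A -> A) (c : A) : Prop :=
  mul c c = c.

Definition eja_primitive (A : vectType R) (mul : A -> A -> A) (c : A) : Prop :=
  [/\ c != 0, eja_idempotent mul c &
      forall a b, eja_idempotent mul a -> eja_idempotent mul b ->
        c = a + b -> a = 0 \/ b = 0].

Definition eja_frame (A : vectType R) (mul : A -> A -> A) (u : A)
    (r : nat) (c : 'I_r -> A) : Prop :=
  [/\ forall i, eja_primitive mul (c i),
      forall i j, i != j -> mul (c i) (c j) = 0 &
      \sum_(i < r) c i = u].

(* The entries of s are, with multiplicity, the coefficients in a spectral
   decomposition of x; by the spectral theorem they do not depend on the
   decomposition, up to order. *)
Definition eja_eigenvalues (A : vectType R) (mul : A -> A -> A) (u : A)
    (x : A) (r : nat) (s : 'rV[R]_r) : Prop :=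
  exists2 c : 'I_r -> A, eja_frame mul u c & x = \sum_(i < r) s 0 i *: c i.

Definition Rn_mul (n : nat) (u v : 'rV[R]_n) : 'rV[R]_n := map2_mx *%R u v.

Definition Rn_dot (n : nat) (u v : 'rV[R]_n) : R := \sum_(i < n) u 0 i * v 0 i.

End EuclideanJordan.

Definition contains_copy_of_Rn (R : realType) (V : vectType R) (n : nat)
    (p : V -> R) (e : V) : Prop :=
  exists (W : {vspace V}) (eW : e \in W)
         (mul : subvs_of W -> subvs_of W -> subvs_of W),
    let dot (x y : subvs_of W) := semi_inner n p e (vsval x) (vsval y) in
    [/\ euclidean_jordan_algebra mul dot (Subvs eW),
        exists phi : {linear subvs_of W -> 'rV[R]_n},
          eja_isomorphism mul dot (@Rn_mul R n) (@Rn_dot R n) phi &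
        forall x : subvs_of W, eja_eigenvalues mul (Subvs eW) x
          (eigenvalue_map n p e (vsval x))].

(* Main.v *)
From HB Require Import structures.
Require Import Defs.
From mathcomp Require Import all_boot all_order all_algebra reals.
From mathcomp Require Import perm polyrcf mpoly.
From mathcomp Require Import ring lra.

(** The heart of the matter is that a primitive idempotent [c] is a direction
    of degree one: [s |-> p (z + s c)] is affine for every [z]
    (lemma [rank_one_affine]).

    To see this, let [nu_1, ..., nu_n] be the eigenvalues of [c + s z], so that
    [p (c + s z) = p e * prod nu_i]. The elementary symmetric functions of the
    squares [nu_i ^ 2] are polynomial in [s], because up to the factor
    [p e ^ 2] they are the coefficients in [t] of
    [p (e + t (c + s z)) * p (e - t (c + s z))]. At [s = 0] the eigenvalues are
    [1, 0, ..., 0], so the second symmetric function [e_2] vanishes there; as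
    it is nonnegative everywhere, it is [O (s ^ 2)]. The sum of the squares
    tends to [1], so one square [nu_1 ^ 2] stays away from [0], and then each of
    the [n - 1] others is at most [e_2 / nu_1 ^ 2 = O (s ^ 2)]. Hence
    [p (c + s z) = O (s ^ (n - 1))], that is, the polynomial [p (c + s z)] is
    divisible by [s ^ (n - 1)]. Being of degree at most [n], it has only the
    terms of degree [n - 1] and [n], and homogeneity turns it into an affine
    polynomial [p (z + s c)]. This replaces the convexity theory of the
    hyperbolicity cone.

    Let now [c_1, ..., c_k] be a Jordan frame. The function
    [a |-> p (sum a_i c_i)] is affine in each [a_i] and homogeneous of degree
    [n]. Comparing the first order terms of
    [p (e + t sum c_i) = (1 + t) ^ n * p e] gives [k = n]
    ([jordan_frame_size]). If some [a_j] is [0], the function involves only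
    [n - 1] variables, so that its degree is less than [n] and homogeneity
    forces it to vanish; it is therefore [p e * prod a_i] ([frame_factor]).
    So the eigenvalues of [sum a_i c_i] are the [a_i], the [c_i] are linearly
    independent, and the coordinates on their span are the isomorphism with
    [R^n].

    The other implications are formal. An isomorphism with [R^n] pulls the
    standard basis back to a Jordan frame, and pulls the componentwise product
    back to a Jordan product on the subspace, the inner products agreeing by
    polarization. For the converse, the primitive idempotents of the algebra
    [R^n] are the vectors of the standard basis ([Rn_primitiveP]), so the
    Jordan-algebra eigenvalues of a vector are its coordinates up to order. *)

Set Implicit Arguments.
Unset Strict Implicit.
Unset Printing Implicit Defensive.

Import Order.TTheory GRing.Theory Num.Theory.
Local Open Scope ring_scope.

(** * Real polynomials near zero *)

Section Univariate.
Variable R : realType.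
Implicit Types (f h : {poly R}) (s : seq R).

Lemma poly_gt_near0 h a : a < h.[0] ->
  exists2 d, 0 < d & forall t, `|t| < d -> a < h.[t].
Proof.
move=> ah; have [|d d0 hd] := @poly_cont R 0 h (h.[0] - a); first by rewrite subr_gt0.
exists d => // t td; have := hd t; rewrite subr0 => /(_ td).
rewrite ltr_norml; lra.
Qed.

(** A simple zero would change sign. *)
Lemma poly_ge0_root0 h : (forall t, 0 <= h.[t]) -> h.[0] = 0 ->
  exists k, h = k * 'X^2.
Proof.
move=> h0 /rootP/factor_theorem [g]; rewrite subr0 => hE.
have g0 : g.[0] = 0.
  apply/eqP; rewrite eq_le; apply/andP; split; rewrite leNgt; apply/negP => gt0.
    have [d d0 hd] := poly_gt_near0 gt0.
    have := hd (- (d / 2)); rewrite normrN gtr0_norm ?divr_gt0 // => /(_ ltac:(lra)).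
    have := h0 (- (d / 2)); rewrite hE hornerM hornerX; nra.
  have gt0' : 0 < (- g).[0] by rewrite hornerN oppr_gt0.
  have [d d0 hd] := poly_gt_near0 gt0'.
  have := hd (d / 2); rewrite gtr0_norm ?divr_gt0 // => /(_ ltac:(lra)).
  have := h0 (d / 2); rewrite hE hornerM hornerX hornerN; nra.
have /rootP/factor_theorem [k] := g0; rewrite subr0 => gE.
by exists k; rewrite hE gE expr2 mulrA.
Qed.

(** Write [f] as [g * 'X^k] with [g.[0] != 0]; if [k < m], dividing the bound by
    [t ^+ (2 * k)] would leave [g.[t] ^+ 2 <= C * t ^+ 2] near [0]. *)
Lemma poly_vanish_order f (m : nat) (C d : R) : 0 < d ->
  (forall t, `|t| < d -> f.[t] ^+ 2 <= C * (t ^+ 2) ^+ m) ->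
  exists g, f = g * 'X^m.
Proof.
move=> d0 fle; have [->|f0] := eqVneq f 0; first by exists 0; rewrite mul0r.
have [k [g]] := multiplicity_XsubC f 0; rewrite f0 subr0 /= => g0 fE.
have [le|lt] := leqP m k.
  by exists (g * 'X^(k - m)); rewrite -mulrA -exprD subnK.
exfalso; have h0 : 0 < (g ^+ 2 - `|C| *: 'X^2).[0].
  rewrite hornerD hornerN hornerZ hornerXn expr0n mulr0 subr0 horner_exp.
  by rewrite exprn_even_gt0.
have [d2 d20 hd] := poly_gt_near0 h0.
pose t := Num.min (Num.min d d2) 1 / 2.
have [t0 td td2 t1] : [/\ 0 < t, t < d, t < d2 & t <= 1].
  rewrite /t; case: (leP d d2) => ?; [case: (leP d 1) | case: (leP d2 1)] => ?;
    by split; lra.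
have := hd t; rewrite gtr0_norm // => /(_ td2).
rewrite hornerD hornerN hornerZ hornerXn horner_exp subr_gt0 ltNge => /negP; apply.
have := fle t; rewrite gtr0_norm // => /(_ td).
rewrite fE hornerM hornerXn exprMn (exprAC _ k 2) => fle2.
have tk : 0 < (t ^+ 2) ^+ k by rewrite !exprn_gt0.
rewrite -(ler_pM2r tk) (le_trans fle2) // -mulrA -exprS.
have t2 : 0 <= t ^+ 2 by rewrite sqr_ge0.
apply: (@le_trans _ _ (`|C| * (t ^+ 2) ^+ m)).
  by rewrite ler_wpM2r ?ler_norm // exprn_ge0.
by rewrite ler_wpM2l // ler_wiXn2l // expr_le1 // ltW.
Qed.

(** * Symmetric functions of squares *)

(** The coefficient of ['X^(2 * k)] is [(-1) ^+ k] times the [k]-th elementary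
    symmetric function of the squares of the entries; it is the form in which
    these functions come out of a product of values of [p]. *)
Definition even_prod s : {poly R} := \prod_(a <- s) (1 - a ^+ 2 *: 'X^2).

Lemma coef_even_prod_cons a s i :
  (even_prod (a :: s))`_i.+2 =
  (even_prod s)`_i.+2 - a ^+ 2 * (even_prod s)`_i.
Proof.
by rewrite /even_prod big_cons mulrBl mul1r coefB -scalerAl coefZ coefXnM subn2.
Qed.

Lemma coef_even_prod s :
  [/\ (even_prod s)`_0 = 1, (even_prod s)`_2 = - \sum_(a <- s) a ^+ 2 &
      0 <= (even_prod s)`_4].
Proof.
elim: s => [|a s [s0 s2 s4]].
  by rewrite /even_prod !big_nil !coef1 /= oppr0.
rewrite !coef_even_prod_cons s0 s2 big_cons; split.
- by rewrite /even_prod big_cons mulrBl mul1r coefB -scalerAl coefZ coefXnM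
    mulr0 subr0.
- by rewrite mulr1 opprD addrC.
- rewrite mulrN opprK addr_ge0 // mulr_ge0 ?sqr_ge0 //.
  by apply: sumr_ge0 => b _; apply: sqr_ge0.
Qed.

Lemma coef4_even_prod_ge a b s : b \in s ->
  a ^+ 2 * b ^+ 2 <= (even_prod (a :: s))`_4.
Proof.
move=> bs; rewrite coef_even_prod_cons.
have [_ -> s4] := coef_even_prod s; rewrite mulrN opprK.
rewrite ler_wpDl // ler_wpM2l ?sqr_ge0 // (big_rem b) //= lerDl.
by apply: sumr_ge0 => c _; apply: sqr_ge0.
Qed.

Lemma even_prod_perm s1 s2 : perm_eq s1 s2 -> even_prod s1 = even_prod s2.
Proof. by move=> s12; apply: perm_big. Qed.

(** The second symmetric function of the squares is at least
    [a ^+ 2 * b ^+ 2] for each of the other entries [b]; multiply these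
    inequalities. *)
Lemma prod_sqr_le (m : nat) s a : size s = m.+2 -> a \in s ->
  \prod_(b <- s) b ^+ 2 * (a ^+ 2) ^+ m <= (even_prod s)`_4 ^+ m.+1.
Proof.
move=> sm /perm_to_rem sE; rewrite (even_prod_perm sE) (perm_big _ sE) /=.
rewrite big_cons mulrAC -exprS.
have := perm_size sE; rewrite sm /= => -[->].
have expE z : z ^+ size (rem a s) = \prod_(b <- rem a s) z.
  by rewrite big_const_seq count_predT iter_mulr_1.
rewrite !expE -big_split /=.
rewrite big_seq [leRHS]big_seq; apply: ler_prod => b bs.
by rewrite mulr_ge0 ?sqr_ge0 //= coef4_even_prod_ge.
Qed.

End Univariate.

(** * Restriction of a homogeneous polynomial to lines *)

Section Polynomial.
Variables (R : realType) (V : vectType R) (n : nat) (p : V -> R).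
Hypothesis phom : homogeneous_poly n p.

Lemma homogeneous_scale t x : p (t *: x) = t ^+ n * p x.
Proof.
case: phom => P Ph pE; rewrite !pE !mevalE mulr_sumr.
apply: eq_big_seq => m mP.
have <- : mdeg m = n by move/dhomogP: Ph; apply.
rewrite mulrCA mdegE -prodrXr -big_split /=; congr (_ * _).
by apply: eq_bigr => i _; rewrite linearZ /= exprMn.
Qed.

(** The scalars enter as polynomials over polynomials, so that the
    coefficients of a power of [t] are polynomials in [s]. *)
Lemma polynomial_family x y z :
  exists G : {poly {poly R}}, forall t s,
    G.[t%:P].[s] = p (x + t *: (y + s *: z)).
Proof.
case: phom => P Ph pE.
pose h i : {poly {poly R}} := (coord (vbasis {:V}) i x)%:P%:P +
  'X * ((coord (vbasis {:V}) i y)%:P + coord (vbasis {:V}) i z *: 'X)%:P.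
exists (\sum_(m <- msupp P) (P@_m)%:P%:P * \prod_i h i ^+ m i) => t s.
rewrite pE mevalE !horner_sum; apply: eq_bigr => m _.
rewrite hornerM !hornerC hornerM hornerC !horner_prod; congr (_ * _).
apply: eq_bigr => i _; rewrite !horner_exp; congr (_ ^+ _).
rewrite /h !hornerE !linearD !linearZ /=; ring.
Qed.


(** The formal polynomial of [t |-> p (y + t v)], an instance of [line_poly]
    in which [v] plays the part of the direction. *)
Definition line y v : {poly R} := line_poly p v (- y).

Lemma lineE y v t : (line y v).[t] = p (y + t *: v).
Proof. by have [-> _ _] := line_polyE v (- y) phom; rewrite opprK addrC. Qed.

Lemma size_line y v : (size (line y v) <= n.+1)%N.
Proof. by have [] := line_polyE v (- y) phom. Qed.

Lemma coef_line_top y v : (line y v)`_n = p v.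
Proof. by have [] := line_polyE v (- y) phom. Qed.

End Polynomial.

(** * Eigenvalues and primitive idempotents *)

Section RankOne.
Variables (R : realType) (V : vectType R) (n : nat) (p : V -> R) (e : V).
Hypothesis hp : hyperbolic_system n p e.

Let phom := hyp_homog hp.
Let pe0 := hyp_val_neq0 hp.
Local Notation roots z := (roots_with_mult (line_poly p e z)).

Lemma size_eigen z : size (roots z) = n.
Proof. by have [] := size_roots z hp. Qed.

Lemma eigen_factor z t : p (t *: e - z) = p e * \prod_(a <- roots z) (t - a).
Proof.
have [<- _ _] := line_polyE e z phom; have [E _] := size_roots z hp.
rewrite [in LHS]E.
rewrite hornerZ horner_prod; congr (_ * _).
by apply: eq_bigr => a _; rewrite !hornerE.
Qed.

Lemma eigen_factor_rev z t :
  p (e + t *: z) = p e * \prod_(a <- roots z) (1 + t * a).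
Proof.
have [->|t0] := eqVneq t 0.
  by rewrite scale0r addr0 big1 ?mulr1 // => a _; rewrite mul0r addr0.
have -> : e + t *: z = (- t) *: ((- t)^-1 *: e - z).
  by rewrite scalerBr scalerA mulfV ?oppr_eq0 // scale1r scaleNr opprK.
rewrite (homogeneous_scale phom) eigen_factor mulrCA; congr (_ * _).
rewrite -(size_eigen z) -[size _]count_predT -iter_mulr_1 -big_const_seq.
rewrite -big_split /=; apply: eq_bigr => a _.
by field.
Qed.

Lemma eigen_even_prod z t :
  p (e + t *: z) * p (e + (- t) *: z) = p e ^+ 2 * (even_prod (roots z)).[t].
Proof.
rewrite !eigen_factor_rev mulrACA -big_split /= -expr2 /even_prod horner_prod.
congr (_ * _); apply: eq_bigr => a _.
rewrite hornerD hornerN hornerZ hornerXn hornerC; ring.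
Qed.

Lemma eigen_sqr z : p z ^+ 2 = p e ^+ 2 * \prod_(a <- roots z) a ^+ 2.
Proof.
have := eigen_factor z 0; rewrite scale0r sub0r -scaleN1r.
rewrite (homogeneous_scale phom) => E.
have -> : p z ^+ 2 = ((-1) ^+ n * p z) ^+ 2 by rewrite exprMn sqrr_sign mul1r.
rewrite E exprMn -prodrXl; congr (_ * _).
by apply: eq_bigr => a _; rewrite sub0r sqrrN.
Qed.

Lemma eigenvalue_map_roots z (f : nat -> R) :
  Defs.eigenvalue_map n p e z = \row_(i < n) f i -> perm_eq (roots z) (mkseq f n).
Proof.
move/rowP => E; rewrite -(perm_sort >=%R).
have -> : sort >=%R (roots z) = mkseq f n => //.
apply: (@eq_from_nth _ 0); rewrite size_sort size_eigen ?size_mkseq // => i lt.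
by have := E (Ordinal lt); rewrite !mxE /= => ->; rewrite nth_mkseq.
Qed.

Lemma primitive_even_prod c : (0 < n)%N -> primitive_idempotent n p e c ->
  even_prod (roots c) = 1 - 'X^2.
Proof.
move=> n0 pc.
have := @eigenvalue_map_roots c (fun i => (i == 0%N)%:R) pc.
move/even_prod_perm ->; rewrite /mkseq -(prednK n0) /= /even_prod big_cons.
rewrite expr1n scale1r big_map big1_seq ?mulr1 // => i /=.
by rewrite mem_iota => /andP[i0 _]; rewrite gtn_eqF // expr0n scale0r subr0.
Qed.

(** The symmetric functions of the squared eigenvalues of [c + s z] are
    polynomial in [s]. *)
Lemma eigen_even_prod_family (c z : V) :
  exists F : {poly {poly R}}, forall (s : R) (i : nat),
    (F`_i).[s] = p e ^+ 2 * (even_prod (roots (c + s *: z)))`_i.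
Proof.
have [G GE] := polynomial_family phom e c z.
exists (G * (G \Po - 'X)) => s i.
rewrite -horner_evalE -coef_map -coefZ.
suff -> : map_poly (horner_eval s) (G * (G \Po - 'X)) =
    p e ^+ 2 *: even_prod (roots (c + s *: z)) by [].
apply: poly_fun_inj => t; rewrite hornerZ -eigen_even_prod.
transitivity ((G * (G \Po - 'X)).[t%:P]).[s].
  have := horner_map (horner_eval s) (G * (G \Po - 'X)) t%:P.
  by rewrite /= /horner_eval hornerC.
by rewrite !hornerM horner_comp hornerN hornerX -polyCN !GE.
Qed.

(** All the eigenvalues of [c + s z] but one are [O(s)] as [s] tends to [0]. *)
Lemma rank_one_vanish (c z : V) : (1 < n)%N -> primitive_idempotent n p e c ->
  exists g : {poly R}, line p c z = g * 'X^(n.-1).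
Proof.
move=> n1 pc; have [F FE] := eigen_even_prod_family c z.
have pe2 : 0 < p e ^+ 2 by rewrite exprn_even_gt0.
have Fc i : (F`_i).[0] = p e ^+ 2 * (1 - 'X^2)`_i.
  by rewrite FE scale0r addr0 (primitive_even_prod (ltnW n1) pc).
(* The second symmetric function of the squared eigenvalues is [O(s ^ 2)]. *)
have [k kE] : exists k, F`_4 = k * 'X^2.
  apply: poly_ge0_root0 => [s|].
    by rewrite FE mulr_ge0 ?(ltW pe2) //; case: (coef_even_prod (roots (c + s *: z))).
  by rewrite Fc coefB coefXn coef1 subrr mulr0.
have [K Kb] := poly_disk_bound k 1.
(* The sum of the squared eigenvalues is more than [1 / 2] near [s = 0]. *)
have [d d0 hd] : exists2 d, 0 < d & forall s, `|s| < d ->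
    p e ^+ 2 / 2 < (- F`_2).[s].
  apply: poly_gt_near0; rewrite hornerN Fc coefB coefXn coef1 sub0r.
  by rewrite mulrN1 opprK; lra.
pose m := n.-2; have nE : n = m.+2 by rewrite /m; case: n n1 => [|[]].
have n0 : 0 < n%:R :> R by rewrite ltr0n ltnW.
pose C := p e ^+ 2 * (2 * n%:R) ^+ m * (K / p e ^+ 2) ^+ m.+1.
rewrite nE; apply: (@poly_vanish_order _ _ _ C (Num.min d 1)).
  by rewrite lt_min d0 ltr01.
move=> s; rewrite lt_min => /andP[sd s1]; rewrite (lineE phom) eigen_sqr.
set r := roots _.
have sr : size r = m.+2 by rewrite size_eigen.
(* So one of the [n] squares exceeds [1 / (2 n)]. *)
have [a ar a2] : exists2 a, a \in r & (2 * n%:R)^-1 < a ^+ 2.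
  apply/hasP; apply/negPn/negP; rewrite -all_predC => /allP /= rle.
  have := hd s sd; rewrite hornerN FE -/r.
  have [_ -> _] := coef_even_prod r; rewrite mulrN opprK.
  rewrite ltr_pM2l // ltNge => /negP; apply.
  apply: (@le_trans _ _ (\sum_(a <- r) (2 * n%:R)^-1)).
    by rewrite big_seq [leRHS]big_seq; apply: ler_sum => a /rle; rewrite -leNgt.
  rewrite big_const_seq count_predT iter_addr_0 sr -nE -[leLHS]mulr_natr.
  by rewrite invfM mulfVK ?gt_eqF.
have e4 : (even_prod r)`_4 <= K / p e ^+ 2 * s ^+ 2.
  rewrite mulrAC ler_pdivlMr // mulrC -FE kE hornerM hornerXn.
  by rewrite ler_wpM2r ?sqr_ge0 // (le_trans (ler_norm _)) // Kb // ltW.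
have e40 : 0 <= (even_prod r)`_4 by case: (coef_even_prod r).
have P0 : 0 <= \prod_(b <- r) b ^+ 2 by apply: prodr_ge0 => b _; apply: sqr_ge0.
have -> : C * (s ^+ 2) ^+ m.+1 = p e ^+ 2 *
    ((2 * n%:R) ^+ m * (K / p e ^+ 2 * s ^+ 2) ^+ m.+1).
  by rewrite /C [(_ * s ^+ 2) ^+ _]exprMn !mulrA.
have n20 : 0 < 2 * n%:R :> R by rewrite mulr_gt0.
rewrite ler_pM2l // mulrC -ler_pdivrMr ?exprn_gt0 // -exprVn.
apply: (@le_trans _ _ (\prod_(b <- r) b ^+ 2 * (a ^+ 2) ^+ m)).
  by rewrite ler_wpM2l // lerXn2r ?nnegrE ?sqr_ge0 ?invr_ge0 // ltW.
by apply: (le_trans (prod_sqr_le sr ar)); rewrite lerXn2r ?nnegrE ?(le_trans e40).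
Qed.

(** Homogeneity reverses the coefficients: [p (z + t c)] is
    [t ^ n * p (c + t^-1 z)], and [p (c + s z)] has no term of degree less than
    [n - 1]. *)
Lemma rank_one_affine (c z : V) s : (1 < n)%N -> primitive_idempotent n p e c ->
  p (z + s *: c) = p z + s * (p (z + c) - p z).
Proof.
move=> n1 pc; have [g fE] := rank_one_vanish z n1 pc.
have [a aE] : exists a, forall t, t != 0 -> p (z + t *: c) = p z + t * a.
  exists (line p c z)`_n.-1 => t t0.
  have -> : z + t *: c = t *: (c + t^-1 *: z).
    by rewrite scalerDr scalerA mulfV // scale1r addrC.
  rewrite (homogeneous_scale phom) -(lineE phom).
  rewrite (horner_coef_wide _ (size_line phom c z)) big_ord_recr /=.
  have lt : (n.-1 < n)%N by rewrite prednK // ltnW.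
  rewrite (coef_line_top phom) (bigD1 (Ordinal lt)) //= big1 => [|i ni].
    rewrite addr0.
  2: by rewrite fE coefMXn ltn_neqAle ni -ltnS prednK ?ltn_ord ?mul0r // ltnW.
  rewrite mulrDr addrC; congr (_ + _).
    by rewrite mulrCA -exprMn mulfV // expr1n mulr1.
  have -> : t ^+ n = t * t ^+ n.-1 by rewrite -exprS prednK // ltnW.
  by rewrite mulrCA -!mulrA -exprMn mulfV // expr1n mulr1 mulrC.
have [->|s0] := eqVneq s 0; first by rewrite scale0r addr0 mul0r addr0.
rewrite aE // -[in p (z + c)](scale1r c) aE ?oner_eq0 //; ring.
Qed.

(** Affineness in [c] at each point of the line, as an identity of polynomials:
    it is what inductions over the members of a frame use. *)
Lemma line_rank_one (c y v : V) a : (1 < n)%N -> primitive_idempotent n p e c ->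
  line p y (v + a *: c) =
  line p y v + (a *: (line p (y + c) v - line p y v)) * 'X.
Proof.
move=> n1 pc; apply: poly_fun_inj => t.
rewrite hornerD hornerM hornerX hornerZ hornerD hornerN !(lineE phom).
rewrite scalerDr addrA scalerA (rank_one_affine _ _ n1 pc).
rewrite [y + c + _]addrAC; ring.
Qed.

(** * The polynomial on the span of a Jordan frame *)

Section Frame.
Variables (k : nat) (c : 'I_k -> V).
Hypotheses (n1 : (1 < n)%N) (fc : jordan_frame n p e c).

Let pc i : primitive_idempotent n p e (c i). Proof. exact: fc.1. Qed.

(** Each [c i] contributes [p e] to the first order term of [p (e + t e)] at
    [t = 0], since [p (e + t (c i)) = p e * (1 + t)]; and
    [p (e + t e) = (1 + t) ^ n * p e]. *)
Lemma jordan_frame_size : k = n.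
Proof.
have coef1_line (s : seq 'I_k) :
    (line p e (\sum_(i <- s) c i))`_1 = (size s)%:R * p e.
  elim: s => [|i s IH].
    rewrite big_nil mul0r.
    have -> : line p e 0 = (p e)%:P by apply: poly_fun_inj => t;
      rewrite (lineE phom) scaler0 addr0 hornerC.
    by rewrite coefC.
  rewrite big_cons addrC -[c i]scale1r line_rank_one // coefD coefMX /=.
  rewrite IH scale1r coefB -!horner_coef0 !(lineE phom) !scale0r !addr0.
  have := eigen_factor_rev (c i) 1; rewrite scale1r => ->.
  rewrite (perm_big _ (eigenvalue_map_roots (f := fun i => (i == 0%N)%:R) (pc i))).
  rewrite /mkseq -(prednK (ltnW n1)) /= big_cons big_map big1_seq => [|j /=].
    by rewrite -natr1; ring.
  by rewrite mem_iota => /andP[i0 _]; rewrite gtn_eqF // mulr0 addr0.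
have := coef1_line (enum 'I_k); rewrite size_enum_ord big_enum /= fc.2.
have -> : line p e e = p e *: ('X + 1) ^+ n.
  apply: poly_fun_inj => t; rewrite (lineE phom) hornerZ horner_exp hornerD.
  by rewrite hornerX hornerC mulrC -(homogeneous_scale phom) scalerDl scale1r addrC.
have -> : (p e *: ('X + 1) ^+ n)`_1 = n%:R * p e.
  rewrite -[LHS]mulr1n -coef_deriv -horner_coef0 derivZ deriv_exp derivD derivX.
  rewrite derivC addr0 mul1r hornerZ hornerMn horner_exp hornerD hornerX hornerC.
  by rewrite add0r expr1n mulrC.
by move/(mulIf pe0)/eqP; rewrite eqr_nat eq_sym => /eqP.
Qed.

Lemma size_line_frame (a : 'I_k -> R) (s : seq 'I_k) y :
  (size (line p y (\sum_(i <- s) a i *: c i)) <= (size s).+1)%N.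
Proof.
elim: s y => [|i s IH] y.
  rewrite big_nil; apply: (leq_trans _ (size_polyC_leq1 (p y))).
  rewrite eq_leq //; congr (size (polyseq _)); apply: poly_fun_inj => t.
  by rewrite (lineE phom) scaler0 addr0 hornerC.
rewrite big_cons addrC line_rank_one //.
rewrite (leq_trans (size_polyD _ _)) // geq_max (leq_trans (IH y)) //=.
rewrite (leq_trans (size_polyMleq _ _)) // size_polyX addn2 /=.
rewrite ltnS (leq_trans (size_scale_leq _ _)) //.
by rewrite (leq_trans (size_polyD _ _)) // size_polyN geq_max !IH.
Qed.

(** On the line from [0], homogeneity makes the value the coefficient of
    degree [n], while only [n - 1] members of the frame are involved. *)
Lemma frame_vanish (a : 'I_k -> R) j : a j = 0 -> p (\sum_i a i *: c i) = 0.
Proof.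
move=> aj; rewrite (bigD1 j) //= aj scale0r add0r.
have -> : \sum_(i < k | i != j) a i *: c i =
    \sum_(i <- enum (predC1 j)) a i *: c i by rewrite big_enum.
rewrite -(coef_line_top phom 0) nth_default //.
apply: (leq_trans (size_line_frame _ _ _)).
by rewrite -cardE cardC1 card_ord prednK ?jordan_frame_size // -jordan_frame_size
  (leq_ltn_trans _ (ltn_ord j)).
Qed.

(** By [frame_vanish] the affine function of each [a j] is linear; the [a j] are
    extracted one by one, starting from [p e = p (\sum_i c i)]. *)
Lemma frame_factor (a : 'I_k -> R) : p (\sum_i a i *: c i) = p e * \prod_i a i.
Proof.
have step (s : seq 'I_k) : uniq s ->
    p (\sum_i (if i \in s then a i else 1) *: c i) = p e * \prod_(i <- s) a i.
  elim: s => [_|j s IH /= /andP[js us]].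
    rewrite big_nil mulr1 -fc.2; congr (p _); apply: eq_bigr => i _.
    by rewrite scale1r.
  rewrite big_cons mulrCA -IH //.
  (* [b t] is the current point with its [j]-th coordinate replaced by [t]. *)
  pose b t i := if i == j then t else if i \in s then a i else 1.
  have bE t : \sum_i b t i *: c i = \sum_i b 0 i *: c i + t *: c j.
    rewrite (bigD1 j) //= [in RHS](bigD1 j) //= /b eqxx scale0r add0r addrC.
    by congr (_ + _); apply: eq_bigr => i /negPf ->.
  have -> : \sum_i (if i \in j :: s then a i else 1) *: c i = \sum_i b (a j) i *: c i.
    by apply: eq_bigr => i _; rewrite /b inE; case: eqP => // ->.
  have -> : \sum_i (if i \in s then a i else 1) *: c i = \sum_i b 1 i *: c i.
    by apply: eq_bigr => i _; rewrite /b; case: eqP => // ->; rewrite (negPf js).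
  rewrite (bE 1) bE rank_one_affine // scale1r.
  by rewrite (@frame_vanish (b 0) j) ?/b ?eqxx // add0r subr0.
have := step (enum 'I_k) (enum_uniq _); rewrite big_enum /= => <-.
by congr (p _); apply: eq_bigr => i _; rewrite mem_enum.
Qed.

End Frame.
End RankOne.

(** * Decreasing rearrangements *)

Section Rearrangement.
Variables (R : realType) (n : nat).
Implicit Types u v : 'rV[R]_n.

Lemma seq_row (g : nat -> R) :
  [seq (\row_(i < n) g i) 0 j | j <- enum 'I_n] = mkseq g n.
Proof.
by rewrite /mkseq -val_enum_ord -map_comp; apply: eq_map => i; rewrite /= mxE.
Qed.

Lemma mkseq_decr u : [seq (decr u) 0 j | j <- enum 'I_n] =
  sort >=%R [seq u 0 j | j <- enum 'I_n].
Proof.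
rewrite /decr seq_row; set s := sort _ _.
by rewrite -[in RHS](mkseq_nth 0 s) size_sort size_map size_enum_ord.
Qed.

Lemma perm_decr u :
  perm_eq [seq (decr u) 0 j | j <- enum 'I_n] [seq u 0 j | j <- enum 'I_n].
Proof. by rewrite mkseq_decr perm_sort. Qed.

Lemma decr_perm_sorted u v :
  perm_eq [seq v 0 j | j <- enum 'I_n] [seq u 0 j | j <- enum 'I_n] ->
  sorted >=%R [seq v 0 j | j <- enum 'I_n] -> decr u = v.
Proof.
move=> uv sv.
have E : sort >=%R [seq u 0 j | j <- enum 'I_n] = [seq v 0 j | j <- enum 'I_n].
  apply: (@sorted_eq _ >=%R) => //.
  - by move=> b a c /= h1 h2; apply: le_trans h2 h1.
  - by move=> a b /=; rewrite andbC => /le_anti.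
  - by apply: sort_sorted => a b; rewrite /= le_total.
  - by rewrite perm_sort perm_sym.
apply/rowP => i; rewrite !mxE E (nth_map i) ?size_enum_ord //.
by rewrite nth_ord_enum.
Qed.

Lemma decr_const u a : decr u = const_mx a -> u = const_mx a.
Proof.
move=> uE; apply/rowP => i.
have : u 0 i \in [seq (decr u) 0 j | j <- enum 'I_n].
  by rewrite (perm_mem (perm_decr u)) map_f // mem_enum.
by rewrite uE => /mapP[j _ ->]; rewrite !mxE.
Qed.

Lemma sqnorm2_decr u : sqnorm2 (decr u) = sqnorm2 u.
Proof.
rewrite /sqnorm2 -!big_enum /= -(big_map (decr u 0) xpredT (fun a => a ^+ 2)).
by rewrite (perm_big _ (perm_decr u)) big_map.
Qed.

Lemma perm_rowP u v :
  perm_eq [seq v 0 j | j <- enum 'I_n] [seq u 0 j | j <- enum 'I_n] <->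
  exists s : 'S_n, forall j, v 0 j = u 0 (s j).
Proof.
rewrite -[X in perm_eq _ X]/(val [tuple u 0 j | j < n]); split.
  move=> /tuple_permP [s sE]; exists s => j.
  have := congr1 (fun r => nth 0 r j) sE.
  rewrite (nth_map j) ?size_enum_ord // nth_ord_enum => ->.
  by rewrite (nth_map j) ?size_enum_ord // nth_ord_enum tnth_mktuple.
move=> [s vE]; apply/tuple_permP; exists s.
by apply: eq_map => j; rewrite tnth_mktuple vE.
Qed.

End Rearrangement.

Lemma decr_delta (R : realType) (n : nat) (i : 'I_n) :
  decr (delta_mx 0 i : 'rV[R]_n) = \row_(j < n) (j == 0 :> nat)%:R.
Proof.
case: n i => [[] //|m] i.
apply: decr_perm_sorted.
  apply/perm_rowP; exists (tperm ord0 i) => j; rewrite !mxE /=.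
  have -> : (tperm ord0 i j == i) = (j == ord0) => //.
  by rewrite -{2}(tpermL ord0 i) (inj_eq perm_inj).
rewrite (seq_row _ (fun j => (j == 0)%:R)) /mkseq sorted_map.
apply: sub_sorted (iota_sorted 0 m.+1) => a b /= ab.
by rewrite ler_nat; case: a ab => [|a]; case: b.
Qed.


(** * Transport of Jordan-algebra notions along an isomorphism *)

Section Transport.
Variables (R : realType) (A B : vectType R) (f : {linear A -> B}).
Variables (mulA : A -> A -> A) (mulB : B -> B -> B).
Hypotheses (fbij : bijective f) (fM : forall a b, f (mulA a b) = mulB (f a) (f b)).

Let finj : injective f. Proof. exact: bij_inj. Qed.

Lemma eja_idempotent_transport c :
  eja_idempotent mulB (f c) <-> eja_idempotent mulA c.
Proof.
by rewrite /eja_idempotent -fM; split => [/finj|->].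
Qed.

Lemma eja_primitive_transport c :
  eja_primitive mulB (f c) <-> eja_primitive mulA c.
Proof.
have f0 a : f a = 0 <-> a = 0.
  by split => [fa|->]; [apply: finj; rewrite fa|]; rewrite linear0.
split=> -[c0 ci cP]; split.
- by apply: contra_neq c0 => ->; rewrite linear0.
- exact/eja_idempotent_transport.
- move=> a b ai bi cE; have := cP (f a) (f b).
  by rewrite !eja_idempotent_transport cE linearD !f0; apply.
- by apply: contra_neq c0 => /f0.
- exact/eja_idempotent_transport.
- have [g fK gK] := fbij; move=> a b.
  rewrite -(gK a) -(gK b) !eja_idempotent_transport -linearD => ai bi /finj cE.
  by rewrite !f0; apply: cP.
Qed.

Lemma eja_frame_transport (u : A) (r : nat) (c : 'I_r -> A) :
  eja_frame mulB (f u) (f \o c) <-> eja_frame mulA u c.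
Proof.
split=> -[c1 c2 c3]; split=> [i|i j ij|].
- exact/eja_primitive_transport/c1.
- by apply: finj; rewrite fM linear0; apply: c2.
- by apply: finj; rewrite linear_sum.
- exact/eja_primitive_transport/c1.
- by rewrite /= -fM c2 ?linear0.
- by rewrite -c3 linear_sum.
Qed.

Lemma eja_eigenvalues_transport (u x : A) (r : nat) (s : 'rV[R]_r) :
  eja_eigenvalues mulB (f u) (f x) s <-> eja_eigenvalues mulA u x s.
Proof.
have [g fK gK] := fbij; split=> -[c cf xE].
  have cE : f \o (g \o c) =1 c by move=> i; rewrite /= gK.
  exists (g \o c).
    apply/eja_frame_transport; case: cf => c1 c2 c3.
    split=> [i|i j ij|]; rewrite ?cE; auto.
    by rewrite -c3; apply: eq_bigr => i _; rewrite cE.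
  apply: finj; rewrite xE linear_sum; apply: eq_bigr => i _.
  by rewrite linearZ -[in LHS]cE.
exists (f \o c); first exact/eja_frame_transport.
by rewrite xE linear_sum; apply: eq_bigr => i _; rewrite linearZ.
Qed.

End Transport.

(** * The Jordan algebra of real vectors *)

Section CoordinateAlgebra.
Variables (R : realType) (n : nat).
Implicit Types u v : 'rV[R]_n.
Local Notation delta i := (delta_mx 0 i : 'rV[R]_n).

Lemma Rn_idempotentP u :
  eja_idempotent (@Rn_mul R n) u <-> forall i, u 0 i = 0 \/ u 0 i = 1.
Proof.
split=> [/rowP ui i|ui].
  have := ui i; rewrite !mxE => /eqP; rewrite -subr_eq0 -{3}[u 0 i]mulr1 -mulrBr.
  by rewrite mulf_eq0 subr_eq0 => /orP[] /eqP; auto.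
by apply/rowP => i; rewrite !mxE; case: (ui i) => ->; rewrite ?mulr0 ?mulr1.
Qed.

(** An idempotent is the indicator of a set of coordinates; splitting off one
    coordinate shows that the set is a singleton if the idempotent is
    primitive. *)
Lemma Rn_primitiveP u :
  eja_primitive (@Rn_mul R n) u <-> exists i, u = delta i.
Proof.
have delta_idem i : eja_idempotent (@Rn_mul R n) (delta i).
  by apply/Rn_idempotentP => j; rewrite mxE; case: (_ && _); auto.
have delta_neq0 i : delta i != 0.
  by apply/eqP => /rowP/(_ i)/eqP; rewrite !mxE !eqxx oner_eq0.
split=> [[u0 /Rn_idempotentP ui uP]|[i ->]].
  have [i ui1] : exists i, u 0 i = 1.
    suff /existsP [i /eqP ui1] : [exists i, u 0 i == 1] by exists i.
    apply: contraNT u0 => /existsPn u1; apply/eqP/rowP => i.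
    by rewrite mxE; case: (ui i) => // /eqP; rewrite (negPf (u1 i)).
  exists i; case: (uP (delta i) (u - delta i)) => //.
  - apply/Rn_idempotentP => j; rewrite !mxE eqxx /=.
    case: eqP => [->|_]; first by left; rewrite ui1 subrr.
    by rewrite subr0.
  - by rewrite addrC subrK.
  - by move=> d0; case/eqP: (delta_neq0 i).
  - by move/eqP; rewrite subr_eq0 => /eqP.
split=> // a b /Rn_idempotentP ai /Rn_idempotentP bi /rowP ab.
have off (c d : 'rV[R]_n) : (forall j, c 0 j = 0 \/ c 0 j = 1) ->
    (forall j, d 0 j = 0 \/ d 0 j = 1) ->
    (forall j, (delta i) 0 j = c 0 j + d 0 j) -> c 0 i = 0 -> c = 0.
  move=> cj dj cd ci; apply/rowP => j; rewrite [RHS]mxE.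
  have [->//|ji] := eqVneq j i.
  have := cd j; rewrite mxE eqxx (negPf ji) /=.
  by case: (cj j) => // ->; case: (dj j) => ->; lra.
have abj j : (delta i) 0 j = a 0 j + b 0 j by rewrite ab mxE.
have baj j : (delta i) 0 j = b 0 j + a 0 j by rewrite abj addrC.
have := abj i; rewrite mxE !eqxx /=.
case: (ai i) => [a0 _|a1]; first by left; apply: off abj a0.
case: (bi i) => [b0 _|->]; first by right; apply: off baj b0.
by rewrite a1 => /eqP; rewrite -subr_eq0 opprD addrA subrr sub0r oppr_eq0 oner_eq0.
Qed.

(** A frame consists of vectors of the standard basis, distinct because they
    are orthogonal: it is the standard basis in some order. *)
Lemma Rn_eigenvaluesP u v :
  eja_eigenvalues (@Rn_mul R n) (const_mx 1) u v <->
  exists s : 'S_n, forall j, v 0 j = u 0 (s j).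
Proof.
split.
  move=> [c [c1 c2 c3] uE].
  have /fin_all_exists [s sE] : forall j, exists i, c j = delta i.
    by move=> j; apply/Rn_primitiveP.
  have sinj : injective s.
    move=> j1 j2 s12; apply/eqP/negPn/negP => /c2; rewrite !sE s12.
    by move=> /rowP/(_ (s j2))/eqP; rewrite !mxE !eqxx mulr1 oner_eq0.
  exists (perm sinj) => j; rewrite permE uE summxE (bigD1 j) //= sE !mxE !eqxx.
  rewrite mulr1 big1 ?addr0 // => i ij; rewrite sE !mxE.
  by rewrite (inj_eq sinj) eq_sym (negPf ij) mulr0.
move=> [s vE]; exists (fun j => delta (s j)).
  split=> [i|i j ij|].
  - by apply/Rn_primitiveP; exists (s i).
  - apply/rowP => l; rewrite !mxE /=.
    have [->|] := eqVneq l (s i); last by rewrite mul0r.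
    by rewrite (inj_eq perm_inj) (negPf ij) mulr0.
  - apply/rowP => l; rewrite summxE (bigD1 ((s^-1)%g l)) //= !mxE permKV !eqxx.
    rewrite big1 ?addr0 // => i il; rewrite !mxE.
    by rewrite -{1}(permKV s l) (inj_eq perm_inj) eq_sym (negPf il).
apply/rowP => l; rewrite summxE (bigD1 ((s^-1)%g l)) //= !mxE vE permKV !eqxx.
rewrite mulr1 big1 ?addr0 // => i il; rewrite !mxE.
by rewrite -{1}(permKV s l) (inj_eq perm_inj) eq_sym (negPf il) mulr0.
Qed.

Lemma Rn_dot_polarization u v :
  4^-1 * (sqnorm2 (u + v) - sqnorm2 (u - v)) = Rn_dot u v.
Proof.
rewrite /sqnorm2 /Rn_dot -sumrB mulr_sumr; apply: eq_bigr => i _.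
by rewrite !mxE; field.
Qed.

End CoordinateAlgebra.

(** * Jordan frames, coordinate subsystems and copies of the algebra *)

Section Main.
Variables (R : realType) (V : vectType R) (n : nat) (p : V -> R) (e : V).
Hypotheses (n1 : (1 < n)%N) (hp : hyperbolic_system n p e).
Let phom := hyp_homog hp.
Let pe0 := hyp_val_neq0 hp.

Lemma eigenvalue_map_decr x (u : 'rV[R]_n) :
  (forall t, p (t *: e - x) = p e * \prod_i (t - u 0 i)) ->
  Defs.eigenvalue_map n p e x = decr u.
Proof.
move=> xE; rewrite /Defs.eigenvalue_map /decr.
have -> : line_poly p e x =
    p e *: \prod_(a <- [seq u 0 j | j <- enum 'I_n]) ('X - a%:P).
  apply: line_poly_eq => t; rewrite hornerZ xE big_map big_enum horner_prod.
  by congr (_ * _); apply: eq_bigr => i _; rewrite !hornerE.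
apply/rowP => i; rewrite !mxE; congr (_`_i).
apply/perm_sortP; last exact: perm_roots_with_mult.
- by move=> a b; rewrite /= le_total.
- by move=> b a c /= h1 h2; apply: le_trans h2 h1.
- by move=> a b /=; rewrite andbC => /le_anti.
Qed.

Lemma eigenvalue_map_dir : Defs.eigenvalue_map n p e e = const_mx 1.
Proof.
rewrite (@eigenvalue_map_decr _ (const_mx 1)) => [|t].
  apply: decr_perm_sorted => //; rewrite sorted_map.
  apply: (@sub_sorted _ (relpre val leq)) => [i j _|].
    by rewrite /= !mxE.
  by rewrite -sorted_map val_enum_ord iota_sorted.
rewrite -{2}[e]scale1r -scalerBl (homogeneous_scale phom) mulrC; congr (_ * _).
under eq_bigr do rewrite mxE.
by rewrite prodr_const card_ord.
Qed.

Lemma eigenvalue_map_sorted x :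
  sorted >=%R [seq (Defs.eigenvalue_map n p e x) 0 j | j <- enum 'I_n].
Proof.
rewrite seq_row; set s := sort _ _.
have <- : size s = n by rewrite size_sort (size_eigen hp).
by rewrite mkseq_nth; apply: sort_sorted => a b; rewrite /= le_total.
Qed.

Lemma jordan_frame_eigenvalues (c : 'I_n -> V) (u : 'rV[R]_n) :
  jordan_frame n p e c ->
  Defs.eigenvalue_map n p e (\sum_i u 0 i *: c i) = decr u.
Proof.
move=> fc; apply: eigenvalue_map_decr => t.
rewrite -{1}fc.2 scaler_sumr -sumrB.
rewrite -(frame_factor hp n1 fc (fun i => t - u 0 i)); congr (p _).
by apply: eq_bigr => i _; rewrite scalerBl.
Qed.

(** If [\sum_i a i *: c i = 0], then [a j *: e] is a combination of the frame
    whose [j]-th coefficient is [0], so [p (a j *: e) = a j ^+ n * p e]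
    vanishes. *)
Lemma jordan_frame_free (c : 'I_n -> V) : jordan_frame n p e c ->
  free [tuple c i | i < n].
Proof.
move=> fc; apply/freeP => a ac0 j.
have ac0' : \sum_i a i *: c i = 0.
  by rewrite -[RHS]ac0; apply: eq_bigr => i _; rewrite -tnth_nth tnth_mktuple.
have := frame_factor hp n1 fc (fun i => a j - a i).
rewrite [X in _ * X](bigD1 j) //= subrr mul0r mulr0.
have -> : \sum_i (a j - a i) *: c i = a j *: e.
  under eq_bigr do rewrite scalerBl.
  by rewrite sumrB ac0' subr0 -scaler_sumr fc.2.
move/eqP; rewrite (homogeneous_scale phom) mulf_eq0 (negPf pe0) orbF.
by rewrite expf_eq0 => /andP[_ /eqP].
Qed.

Lemma isomorphic_of_jordan_frame k (c : 'I_k -> V) : jordan_frame n p e c ->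
  exists W : {vspace V}, e \in W /\ isomorphic_to_En n p e W.
Proof.
move=> fc; have kn := jordan_frame_size hp n1 fc; subst k.
pose X := [tuple c i | i < n]; have Xfree : free X := jordan_frame_free fc.
have XE (i : 'I_n) : X`_i = c i by rewrite -tnth_nth tnth_mktuple.
have Xin i : c i \in <<X>>%VS by rewrite -XE memv_span // mem_nth // size_tuple.
exists <<X>>%VS; split; first by rewrite -fc.2 rpred_sum.
pose phi (x : subvs_of <<X>>%VS) : 'rV[R]_n := \row_i coord X i (vsval x).
have philin : linear phi.
  by move=> a x y; apply/rowP => i; rewrite !mxE !linearP.
pose L := GRing.isLinear.Build R (subvs_of <<X>>%VS) 'rV[R]_n *:%R phi philin.
pose phiL : {linear subvs_of <<X>>%VS -> 'rV[R]_n} := HB.pack phi L.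
have valE (x : subvs_of <<X>>%VS) : vsval x = \sum_i (phi x) 0 i *: c i.
  rewrite [LHS](coord_span (subvsP x)).
  by apply: eq_bigr => i _; rewrite mxE XE.
exists phiL; split; last by move=> x; rewrite [in RHS]valE jordan_frame_eigenvalues.
exists (fun u : 'rV[R]_n => vsproj <<X>>%VS (\sum_i u 0 i *: c i)) => [x|u].
  by apply: val_inj; rewrite /= -valE vsprojK // subvsP.
apply/rowP => i; rewrite mxE /= vsprojK ?rpred_sum // => [|j _]; last exact: rpredZ.
under eq_bigr do rewrite -XE.
by rewrite coord_sum_free.
Qed.

Section Isomorphic.
Variables (W : {vspace V}) (phi : {linear subvs_of W -> 'rV[R]_n}).
Hypotheses (eW : e \in W) (phibij : bijective phi).
Hypothesis phiE : forall x : subvs_of W,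
  decr (phi x) = Defs.eigenvalue_map n p e (vsval x).

(** All the eigenvalues of [e] are [1], and an arrangement of equal numbers does
    not depend on the order. *)
Lemma isomorphism_unit : phi (Subvs eW) = const_mx 1.
Proof. by apply: decr_const; rewrite phiE /= eigenvalue_map_dir. Qed.

Lemma jordan_frame_of_isomorphic :
  exists (k : nat) (c : 'I_k -> V), jordan_frame n p e c.
Proof.
have [g phiK gK] := phibij.
exists n, (fun i => vsval (g (delta_mx 0 i))); split.
  by move=> i; rewrite /primitive_idempotent -phiE gK decr_delta.
rewrite -linear_sum /=; have -> : e = vsval (Subvs eW) by [].
congr (vsval _); apply: (bij_inj phibij); rewrite linear_sum isomorphism_unit.
apply/rowP => j; rewrite summxE (bigD1 j) //= gK !mxE !eqxx.
by rewrite big1 ?addr0 // => i ij; rewrite gK mxE eq_sym (negPf ij).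
Qed.

Lemma copy_of_isomorphic : contains_copy_of_Rn n p e.
Proof.
have [g phiK gK] := phibij.
pose mul x y := g (Rn_mul (phi x) (phi y)).
have phiM x y : phi (mul x y) = Rn_mul (phi x) (phi y) by rewrite gK.
have dotE (x y : subvs_of W) :
    semi_inner n p e (vsval x) (vsval y) = Rn_dot (phi x) (phi y).
  rewrite /semi_inner -Rn_dot_polarization -linearD -linearB -!phiE.
  by rewrite !sqnorm2_decr linearD linearB.
have phi_inj := bij_inj phibij.
exists W, eW, mul; split.
- split.
  + move=> b a x y; apply: phi_inj; rewrite linearP !phiM linearP.
    by apply/rowP => i; rewrite !mxE mulrDl mulrA.
  + move=> b a x y; apply: phi_inj; rewrite linearP !phiM linearP.
    by apply/rowP => i; rewrite !mxE mulrDr mulrCA.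
  + by move=> x y; apply: phi_inj; rewrite !phiM; apply/rowP => i; rewrite !mxE mulrC.
  + move=> x y; apply: phi_inj; rewrite !phiM; apply/rowP => i; rewrite !mxE.
    by rewrite mulrCA.
  + move=> x; apply: phi_inj; rewrite phiM isomorphism_unit.
    by apply/rowP => i; rewrite !mxE mul1r.
  + move=> b a x y; rewrite !dotE linearP /Rn_dot mulr_sumr -big_split /=.
    by apply: eq_bigr => i _; rewrite !mxE mulrDl mulrA.
  + by move=> x y; rewrite !dotE; apply: eq_bigr => i _; rewrite mulrC.
  + move=> x x0; rewrite dotE; have : phi x != 0.
      by apply: contra_neq x0 => px; apply: phi_inj; rewrite px linear0.
    apply: contra_neqT; rewrite -leNgt => le0; apply/rowP => i; rewrite mxE.
    have sq0 j : true -> 0 <= phi x 0 j * phi x 0 j by rewrite -expr2 sqr_ge0.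
    have /eqP : Rn_dot (phi x) (phi x) = 0.
      by apply/eqP; rewrite eq_le le0 sumr_ge0.
    rewrite psumr_eq0 // => /allP/(_ i (mem_index_enum _)).
    by rewrite mulf_eq0 orbb => /eqP.
  + move=> x y z; rewrite !dotE !phiM; apply: eq_bigr => i _.
    by rewrite !mxE mulrA [_ * phi y 0 i]mulrC.
- by exists phi; split=> // x y; rewrite dotE.
- move=> x; apply/(eja_eigenvalues_transport phibij phiM).
  rewrite isomorphism_unit; apply/Rn_eigenvaluesP/perm_rowP.
  by rewrite -phiE perm_decr.
Qed.

End Isomorphic.

(** The product determines the Jordan-algebra eigenvalues of [x] as the
    coordinates of [phi x] up to order, and the eigenvalue map is sorted. *)
Lemma isomorphic_of_copy : contains_copy_of_Rn n p e ->
  exists W : {vspace V}, e \in W /\ isomorphic_to_En n p e W.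
Proof.
move=> [W [eW [mul [eja [phi [phibij phiM _] ev]]]]].
exists W; split=> //; exists phi; split=> // x.
have unit : phi (Subvs eW) = const_mx 1.
  have [g phiK gK] := phibij.
  have := phiM (Subvs eW) (g (const_mx 1)); rewrite (eja_mul1 eja) gK.
  by move=> /rowP E; apply/rowP => i; have := E i; rewrite !mxE mulr1.
have /(eja_eigenvalues_transport phibij phiM) := ev x.
rewrite unit => /Rn_eigenvaluesP/perm_rowP xE.
by apply: decr_perm_sorted xE _; apply: eigenvalue_map_sorted.
Qed.

End Main.

Theorem theorem4p17 (R : realType) (V : vectType R) (n : nat)
    (p : V -> R) (e : V) (hn : (2 <= n)%N)
    (hp : hyperbolic_system n p e) :
  ((exists (k : nat) (c : 'I_k -> V), jordan_frame n p e c) <->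
   (exists W : {vspace V}, e \in W /\ isomorphic_to_En n p e W)) /\
  ((exists (k : nat) (c : 'I_k -> V), jordan_frame n p e c) <->
   contains_copy_of_Rn n p e).
Proof.
have frame_iso : (exists (k : nat) (c : 'I_k -> V), jordan_frame n p e c) ->
    exists W : {vspace V}, e \in W /\ isomorphic_to_En n p e W.
  by move=> [k [c fc]]; exact: (isomorphic_of_jordan_frame hn hp fc).
have iso_frame : (exists W : {vspace V}, e \in W /\ isomorphic_to_En n p e W) ->
    exists (k : nat) (c : 'I_k -> V), jordan_frame n p e c.
  by move=> [W [eW [phi [bij phiE]]]]; apply: (jordan_frame_of_isomorphic hp eW bij).
split; split=> //.
  move/frame_iso => [W [eW [phi [bij phiE]]]].
  exact: (copy_of_isomorphic hp eW bij).
by move/(isomorphic_of_copy hp)/iso_frame.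
Qed.
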